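(* Let $n\geqslant 2$ be an integer. For a pair of unidirectional carousels in which each carousel prepares by rotating to the first item it encounters, the distribution function $F_S$ of the steady-state sojourn time $S$ of the picker satisfies, for $0\leqslant x\leqslant 1$, $$F_S(x)=nx^{n-1}-(n-1)x^n-nx^{n-1}\int_0^{1-x}F_S(z)\,dz.$$
   Context: Model. A carousel is a circle of length $1$ rotating at unit speed. Each order consists of $n$ items whose positions are independent and uniformly distributed on the circle. One picker alternates between two carousels, picking one order at each visit; switching and item-removal times are ignored. For an order, the preparation time $B$ is the rotation time from the carousel's current position (the origin) to the first item to be picked, and the pick (travel) time $A$ is the rotation time needed, after the first item is reached, to visit the remaining $n-1$ items. Strategy considered. The carousel rotates in one fixed direction only: $B$ is the distance from the origin to the first item encountered in that direction, and $A$ is the distance from that first item to the last item encountered in that direction. (Thus $A$ has density $n(n-1)(1-y)y^{n-2}$ on $(0,1)$, and given $A=y$, $B$ is uniform on $[0,1-y]$.) Sojourn time. The sojourn times of successive orders satisfy $S_{k+1}=(B_{k+1}-S_k)^++A_{k+1}$, $S_1=B_1+A_1$, where the pairs $(A_k,B_k)$ are i.i.d. copies of $(A,B)$ and $u^+=\max\{0,u\}$. $S$ is distributed according to the (unique) limiting distribution of $S_k$ as $k\to\infty$, so that $S\stackrel{\mathcal{D}}{=}(B-S)^++A$ with $S$ on the right-hand side independent of $(A,B)$. It is assumed that $0\leqslant S\leqslant 1$ (so $F_S(1)=1$), $F_S(0)=0$ and that $S$ has a density. *)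

(* Defs.v *)
From HB Require Import structures.
From mathcomp Require Import all_boot all_order all_algebra finmap.
From mathcomp Require Import all_classical all_reals all_analysis.
From mathcomp Require Import measurable_realfun.

Set Implicit Arguments.
Unset Strict Implicit.
Unset Printing Implicit Defensive.

Import Order.TTheory GRing.Theory Num.Def Num.Theory.
Import numFieldNormedType.Exports.

Local Open Scope classical_set_scope.
Local Open Scope ring_scope.

Definition mutually_independent d (T : measurableType d) (R : realType)
    (P : probability T R) (I : choiceType) (X : I -> {RV P >-> R}) : Prop :=
  forall (J : {fset I}) (E : I -> set R), (forall i, measurable (E i)) ->
  P (\bigcap_(i in [set` J]) (X i @^-1` E i)) =
  (\prod_(i <- J) P (X i @^-1` E i))%E.

Definition uniform01 d (T : measurableType d) (R : realType)
    (P : probability T R) (X : {RV P >-> R}) : Prop :=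
  forall E : set R, measurable E ->
  distribution P X E = uniform_prob (@ltr01 R) E.

(* The X_k and X need not live on the same probability space. *)
Definition cvg_in_distribution d d' (T : measurableType d)
    (T' : measurableType d') (R : realType) (P : probability T R)
    (P' : probability T' R) (X_ : nat -> {RV P >-> R}) (X : {RV P' >-> R})
    : Prop :=
  forall x : R, {for x, continuous (cdf X)} ->
  cdf (X_ k) x @[k --> \oo] --> cdf X x.

Definition has_density d (T : measurableType d) (R : realType)
    (P : probability T R) (X : {RV P >-> R}) : Prop :=
  exists f : R -> R, [/\ measurable_fun setT f, forall z, 0 <= f z &
    forall E : set R, measurable E ->
    distribution P X E = (\int[lebesgue_measure]_(z in E) (f z)%:E)%E].

Section carousel.
Context d (T : measurableType d) (R : realType) (P : probability T R).
Variables (n : nat) (U : nat -> 'I_n -> {RV P >-> R}).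

(* [U k i w] is the position of item [i] of order [k], as the distance to it
   from the origin (the current position of the carousel) in the direction in
   which items are encountered.  Hence the first item encountered is the one of
   least position, and the last one that of greatest position.  For
   [0 < n] and positions in [0, 1], the default values 1 and 0 are neutral. *)
Definition first_item k (w : T) : R := \big[minr/1]_(i < n) U k i w.

Definition last_item k (w : T) : R := \big[maxr/0]_(i < n) U k i w.

Definition preparation_time k (w : T) : R := first_item k w.

Definition pick_time k (w : T) : R := last_item k w - first_item k w.

(* Orders are numbered from 0. *)
Fixpoint sojourn_time k (w : T) : R :=
  if k is j.+1 then
    maxr 0 (preparation_time j.+1 w - sojourn_time j w) + pick_time j.+1 w
  else preparation_time 0 w + pick_time 0 w.

Lemma measurable_first_item k : measurable_fun setT (first_item k).
Proof.
rewrite /first_item unlock.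
elim: (index_enum _) => [|i s IHs]; first exact: measurable_cst.
exact: (measurable_minr (measurable_funPT (U k i)) IHs).
Qed.

Lemma measurable_last_item k : measurable_fun setT (last_item k).
Proof.
rewrite /last_item unlock.
elim: (index_enum _) => [|i s IHs]; first exact: measurable_cst.
exact: (measurable_maxr (measurable_funPT (U k i)) IHs).
Qed.

Lemma measurable_sojourn_time k : measurable_fun setT (sojourn_time k).
Proof.
have mB j := measurable_first_item j.
have mA j : measurable_fun setT (pick_time j).
  exact: measurable_funB (measurable_last_item j) (mB j).
elim: k => [|k IHk]; first exact: measurable_funD (mB 0) (mA 0).
apply: measurable_funD (mA k.+1).
by apply: measurable_maxr => //; exact: measurable_funB (mB k.+1) IHk.
Qed.

HB.instance Definition _ k :=
  isMeasurableFun.Build _ _ _ _ (sojourn_time k) (measurable_sojourn_time k).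

Definition sojourn_RV k : {RV P >-> R} := sojourn_time k.

End carousel.

(* Main.v *)
From HB Require Import structures.
Require Import Defs.
From mathcomp Require Import all_boot all_order all_algebra finmap.
From mathcomp Require Import all_classical all_reals all_analysis.
From mathcomp Require Import measurable_realfun.
From mathcomp Require Import lra ring.

Set Implicit Arguments.
Unset Strict Implicit.
Unset Printing Implicit Defensive.

Import Order.TTheory GRing.Theory Num.Def Num.Theory.
Import numFieldNormedType.Exports.

Local Open Scope classical_set_scope.
Local Open Scope ring_scope.

(* Let m and M be the least and greatest of the n positions of order k+1.  Since
   max(0, m - s) + (M - m) = M - min(m, s), almost surely S_{k+1} <= x iff
   M - m <= x and M - x <= S_k.  Conditioning on the item that realises M, with
   position u, the other n - 1 items must lie in [max(0, u - x), u] and S_k, which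
   is independent of order k+1, must be at least u - x.  Hence
     P(S_{k+1} <= x) = n * \int_0^1 min(u, x)^(n-1) * P(S_k >= u - x) du.
   The limiting distribution function F is continuous, so dominated convergence
   gives F(x) = n * \int_0^1 min(u, x)^(n-1) * (1 - F(u - x)) du, and splitting
   this integral at u = x yields the formula. *)

(** * Independence from a generated sigma-algebra *)

Section independence.
Context d (T : measurableType d) (R : realType) (P : probability T R).
Context (I : choiceType) (X : I -> {RV P >-> R}).

Definition cylinder (J : {fset I}) (E : I -> set R) : set T :=
  \bigcap_(i in [set` J]) (X i @^-1` E i).

(** A pi-system generating the sigma-algebra of the [X i] with [i] in [K]. Independence is checked
    on it and then extended. *)
Definition cylinders (K : set I) : set (set T) :=
  [set A | exists (J : {fset I}) (E : I -> set R),
    [/\ [set` J] `<=` K, forall i, measurable (E i) & A = cylinder J E]].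

Lemma measurable_cylinder (J : {fset I}) (E : I -> set R) :
  (forall i, measurable (E i)) -> measurable (cylinder J E).
Proof.
move=> mE; apply: fin_bigcap_measurable => // i _; exact: measurable_funPTI.
Qed.

Lemma sigma_cylinders_measurable (K : set I) :
  <<s cylinders K >> `<=` measurable.
Proof.
apply: smallest_sub; first exact: sigma_algebra_measurable.
by move=> _ [J [E [_ mE ->]]]; exact: measurable_cylinder.
Qed.

Lemma cylinders_setI_closed (K : set I) : setI_closed (cylinders K).
Proof.
move=> _ _ [J [E [JK mE ->]]] [J' [E' [JK' mE' ->]]].
exists (J `|` J')%fset, (fun i => (if i \in J then E i else setT) `&`
                                  (if i \in J' then E' i else setT)); split.
- by move=> i /=; rewrite in_fsetU => /orP[]; [exact: JK | exact: JK'].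
- by move=> i; apply: measurableI; case: ifP.
- rewrite /cylinder predeqE => w; split => [[Jw J'w] i /=|h].
    rewrite in_fsetU => _; split.
      by case: ifPn => // iJ; exact: Jw.
    by case: ifPn => // iJ; exact: J'w.
  split=> i /= iJ; have := h i; rewrite /= in_fsetU iJ ?orbT => /(_ isT)[]//.
Qed.

(** Dynkin's pi-lambda argument: the events independent of a fixed cylinder form a lambda-system,
    and this system contains the cylinders over [K] because [J] does not meet [K]. *)
Lemma cylinder_sigma_indep (J : {fset I}) (K : set I) (E : I -> set R)
    (B : set T) :
  mutually_independent X -> (forall i, i \in J -> ~ K i) ->
  (forall i, measurable (E i)) -> <<s cylinders K >> B ->
  P (cylinder J E `&` B) = (P (cylinder J E) * P B)%E.
Proof.
move=> indX JK mE.
set A := cylinder J E.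
have mA : measurable A by exact: measurable_cylinder.
suff : <<s cylinders K >> `<=` [set B | measurable B /\
    P (A `&` B) = (P A * P B)%E] by move=> /[apply] -[].
apply: lambda_system_subset => //.
- exact: cylinders_setI_closed.
- apply/dynkin_lambda_system; split => /=.
  + by split => //; rewrite setIT probability_setT mule1.
  + move=> C [mC PC]; split; first exact: measurableC.
    rewrite -setDE measureD ?ltey_eq ?fin_num_measure //.
    rewrite [X in (_ - X)%E]PC probability_setC // muleBr ?mule1 ?fin_num_measure //.
  + move=> F tF FH; have mF n : measurable (F n) by have [] := FH n.
    split; first exact: bigcupT_measurable.
    rewrite setI_bigcupr measure_semi_bigcup; last 3 first.
    * by move=> i; exact: measurableI.
    * exact: trivIset_setIl.
    * by apply: bigcupT_measurable => i; exact: measurableI.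
    rewrite measure_semi_bigcup //; last exact: bigcupT_measurable.
    have PA : P A = (fine (P A))%:E by rewrite fineK // fin_num_measure.
    rewrite PA -nneseriesZl //; apply: eq_eseriesr => i _.
    by rewrite -PA; have [] := FH i.
- move=> _ [L [F [LK mF ->]]]; split; first exact: measurable_cylinder.
  have dJL i : i \in J -> i \notin L.
    by move=> iJ; apply/negP => iL; apply: (JK i iJ); exact: LK.
  (* The index sets being disjoint, both families of constraints glue into one cylinder over the
     union. Mutual independence applies to it, and its product splits in two. *)
  pose G i := if i \in J then E i else F i.
  have mG i : measurable (G i) by rewrite /G; case: ifP.
  rewrite /A /cylinder (indX J E mE) (indX L F mF).
  rewrite [X in P X](_ : _ = cylinder (J `|` L)%fset G); last first.
    rewrite predeqE => w; split => [[Jw Lw] i /=|h].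
      rewrite in_fsetU /G; case: ifPn => [iJ _|_ /=]; [exact: Jw|exact: Lw].
    split=> i /= iJ; have := h i; rewrite /= in_fsetU iJ ?orbT => /(_ isT).
      by rewrite /G iJ.
    by rewrite /G ifN //; apply/negP => /dJL; rewrite iJ.
  rewrite /cylinder (indX _ _ mG) (perm_big (enum_fset J ++ enum_fset L)).
    rewrite big_cat /=.
    congr (_ * _)%E; apply: eq_big_seq => i iJ; rewrite /G ?iJ //.
    by rewrite ifN //; apply/negP => /dJL; rewrite iJ.
  apply: uniq_perm; rewrite ?cat_uniq ?fset_uniq ?andbT /= //.
    by apply/hasPn => i iL; apply/negP => /dJL; rewrite iL.
  by move=> i; rewrite in_fsetU mem_cat.
Qed.

Lemma measurable_coordinate (K : set I) (i : I) : K i ->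
  @measurable_fun _ _ (g_sigma_algebraType (cylinders K)) _ setT (X i).
Proof.
move=> Ki _ E mE; rewrite setTI; apply: sub_gen_smallest.
exists [fset i]%fset, (fun=> E); split => //.
  by move=> j /=; rewrite in_fset1 => /eqP ->.
rewrite /cylinder predeqE => w; split => [Ew j /=|].
  by rewrite in_fset1 => /eqP ->.
by apply; rewrite /= in_fset1.
Qed.

(** Makes the identity a random element of the coarser measurable space, so that everything
    determined by the coordinates in [K] is handled through a single joint law. *)
Lemma measurable_id_cylinders (K : set I) :
  @measurable_fun _ _ T (g_sigma_algebraType (cylinders K)) setT id.
Proof.
by move=> _ B sB; rewrite setTI; exact: sigma_cylinders_measurable sB.
Qed.

Lemma measurable_prob_section (K : set I)
    (D : set (R * g_sigma_algebraType (cylinders K))) :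
  measurable D -> measurable_fun setT (fun u => P [set w | D (u, w)]).
Proof.
move=> mD; pose T2 := g_sigma_algebraType (cylinders K).
pose W : {mfun T >-> T2} := HB.pack (id : T -> T2)
  (isMeasurableFun.Build _ _ T T2 id (@measurable_id_cylinders K)).
have := measurable_fun_xsection (distribution P W) mD.
congr measurable_fun; apply/funext => u /=.
rewrite /distribution /pushforward /xsection; congr (P _).
by apply/seteqP; split => w /=; rewrite inE.
Qed.

(** Since [X i] is independent of the sigma-algebra of [K], the joint law of [X i] and the identity
    is a product measure, and Fubini computes it by sections: the value of [X i] may be frozen and
    then averaged. *)
Lemma indep_integral_section (i : I) (K : set I)
    (D : set (R * g_sigma_algebraType (cylinders K))) :
  mutually_independent X -> ~ K i -> measurable D ->
  P [set w | D (X i w, w)] =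
  (\int[P]_v P [set w | D (X i v, w)])%E.
Proof.
move=> indX Ki mD.
pose T2 := g_sigma_algebraType (cylinders K).
pose W : {mfun T >-> T2} := HB.pack (id : T -> T2)
  (isMeasurableFun.Build _ _ T T2 id (@measurable_id_cylinders K)).
have mXW : measurable_fun [set: T] (fun w => (X i w, W w)).
  by apply: measurable_fun_pair => //.
pose XW : {mfun T >-> (R * T2)%type} := HB.pack (fun w => (X i w, W w))
  (isMeasurableFun.Build _ _ T (R * T2)%type _ mXW).
have -> : P [set w | D (X i w, w)] = distribution P XW D by [].
rewrite -(@ge0_integral_distribution _ _ _ _ _ P (X i)
  (fun u => P [set w | D (u, w)])) //; last exact: measurable_prob_section.
rewrite -(@product_measure_unique _ _ _ _ _ (distribution P (X i))
  (distribution P W) (distribution P XW) _ D mD).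
  apply: eq_integral => u _ /=.
  by rewrite /distribution /pushforward /xsection; congr (P _);
    apply/seteqP; split => w /=; rewrite inE.
(* A product measure is determined by rectangles, where the claim is the independence of a one-index
   cylinder from [B]. *)
move=> A B mA mB; rewrite /distribution /pushforward /=.
rewrite -[X in (X * _)%E](_ : P (cylinder [fset i]%fset (fun=> A)) = _).
  rewrite -(@cylinder_sigma_indep _ K) //.
  - congr (P _); rewrite predeqE => w; split => /=.
      by move=> [Aw Bw]; split => // j /=; rewrite in_fset1 => /eqP ->.
    by move=> [Aw Bw]; split => //; apply: (Aw i); rewrite /= in_fset1.
  - by move=> j; rewrite in_fset1 => /eqP ->.
by rewrite /cylinder set_fset1 bigcap_set1.
Qed.

End independence.

(** * Recurrence for the law of the sojourn time *)

Lemma measurable_ler_set d (T : measurableType d) (R : realType) (f g : T -> R) :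
  measurable_fun setT f -> measurable_fun setT g ->
  measurable [set w | f w <= g w].
Proof.
move=> mf mg; rewrite -[X in measurable X]setTI.
exact: (measurable_fun_ler mf mg measurableT (Y := [set true])).
Qed.

Lemma measurable_ltr_set d (T : measurableType d) (R : realType) (f g : T -> R) :
  measurable_fun setT f -> measurable_fun setT g ->
  measurable [set w | f w < g w].
Proof.
move=> mf mg; rewrite -[X in measurable X]setTI.
exact: (measurable_fun_ltr mf mg measurableT (Y := [set true])).
Qed.

(** Take the least index among the maximisers. Strictness below it is the tie-breaking rule of the
    windows defined later; [i0] only witnesses that the index type is inhabited. *)
Lemma first_argmax (R : realType) (n : nat) (f : 'I_n -> R) (i0 : 'I_n) :
  exists i, forall j, f j <= f i /\ ((j < i)%N -> f j < f i).
Proof.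
pose m := [arg max_(i > i0) f i]%O.
have fm j : f j <= f m by rewrite /m; case: arg_maxP => //= i _ h; exact: h.
pose i := [arg min_(i < m | f i == f m) (i : nat)]%N.
have [fi ile] : f i = f m /\ (forall j, f j = f m -> (i <= j)%N).
  rewrite /i; case: arg_minnP => //= j /eqP fj h; split => // l fl.
  by apply: h; rewrite fl.
exists i => j; split; first by rewrite fi.
move=> ji; rewrite fi lt_neqAle fm andbT; apply/eqP => /ile.
by rewrite leqNgt ji.
Qed.

Section sojourn.
Context d (T : measurableType d) (R : realType) (P : probability T R).
Variables (n : nat) (U : nat -> 'I_n -> {RV P >-> R}).
Hypothesis n_gt0 : (0 < n)%N.

Let X := fun ki : nat * 'I_n => U ki.1 ki.2.

(* [max(0, m - s) + (M - m) = M - min(m, s)]. *)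
Lemma sojourn_timeS_le k w x : (sojourn_time U k.+1 w <= x) =
  (last_item U k.+1 w - x <= first_item U k.+1 w) &&
  (last_item U k.+1 w - x <= sojourn_time U k w).
Proof.
rewrite /= /pick_time /preparation_time addr_maxl ge_max.
by congr andb; apply/idP/idP; lra.
Qed.

(* For positions in [0, 1] and [U_i = u]: item [i] is the last one and
   [M - m <= x] iff each other item [j] is in [window x i j u].  Excluding [u]
   when [j < i] breaks ties, so that the events [last_is] are disjoint. *)
Definition window (x : R) (i j : 'I_n) (u : R) : set R :=
  [set` Interval (BLeft (maxr 0 (u - x))) (BSide (j < i)%N u)].

Definition last_is (x : R) k (i : 'I_n) : set (R * T) :=
  [set p | (forall j, j != i -> window x i j p.1 (U k.+1 j p.2)) /\
           p.1 - x <= sojourn_time U k p.2].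

Lemma windowP x i j u v : window x i j u v <->
  [/\ 0 <= v, u - x <= v, v <= u & (j < i)%N -> v < u].
Proof.
rewrite /window /= itv_boundlr bnd_simp ge_max /=.
case: (ltnP j i) => ji; rewrite bnd_simp; split.
- by case/andP => /andP[? ?] ?; split => //; exact: ltW.
- by case=> -> -> _ ->.
- by case/andP => /andP[? ?] ?; split => //; exact: ltW.
- by case=> -> -> -> _.
Qed.

(** The witness is the first index that realises the greatest position. Conversely, the windows put
    every position between [U_i - x] and [U_i], which bounds both extremes. *)
Lemma sojourn_timeS_leE k w x : 0 <= x ->
  (forall i, 0 <= U k.+1 i w <= 1) ->
  sojourn_time U k.+1 w <= x <-> exists i, last_is x k i (U k.+1 i w, w).
Proof.
move=> x0 U01; rewrite sojourn_timeS_le; split.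
- move=> /andP[MmS MS].
  have [i imax] := first_argmax (fun i => U k.+1 i w) (Ordinal n_gt0).
  have UM : U k.+1 i w <= last_item U k.+1 w.
    exact: (le_bigmax _ (fun i => U k.+1 i w)).
  exists i; split => /= [j ji|]; last by apply: le_trans MS; rewrite lerD2r.
  have [ij ij'] := imax j; apply/windowP; split => //.
    by have /andP[] := U01 j.
  apply: (@le_trans _ _ (first_item U k.+1 w)); last first.
    exact: (bigmin_le _ _ (fun i => U k.+1 i w)).
  by apply: le_trans MmS; rewrite lerD2r.
- move=> [i [/= win iS]].
  (* The default value 0 of the maximum is at most [U_i]; further down, the default value 1 of the
     minimum is at least [U_i - x]. *)
  have MU : last_item U k.+1 w <= U k.+1 i w.
    apply: bigmax_le; first by have /andP[] := U01 i.
    move=> j _; have [->//|ji] := eqVneq j i.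
    by have /windowP[] := win j ji.
  apply/andP; split; last by apply: le_trans iS; rewrite lerD2r.
  apply: (@le_trans _ _ (U k.+1 i w - x)); first by rewrite lerD2r.
  apply: le_bigmin; first by have /andP[] := U01 i; lra.
  move=> j _; have [->|ji] := eqVneq j i; first by lra.
  by have /windowP[] := win j ji.
Qed.

(** For [i < i'], the window around [U_i] allows equality and gives [U_i' <= U_i], while the one
    around [U_i'] excludes it and gives [U_i < U_i']. *)
Lemma last_is_inj k w x i i' :
  last_is x k i (U k.+1 i w, w) -> last_is x k i' (U k.+1 i' w, w) -> i = i'.
Proof.
wlog ii' : i i' / (i < i')%N.
  move=> h; case: (ltngtP i i') => [ii'|ii'|/val_inj//]; first exact: h.
  by move=> hi hi'; apply/esym; exact: h hi' hi.
move=> [/= win _] [/= win' _].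
have ne : i' != i by rewrite neq_ltn ii' orbT.
have /windowP[_ _ le_ii' _] := win i' ne.
rewrite eq_sym in ne; have /windowP[_ _ _ /(_ ii')] := win' i ne.
by rewrite ltNge le_ii'.
Qed.

Section sigma.
Variable K : set (nat * 'I_n).
Let T2 := g_sigma_algebraType (cylinders X K).

(** Measurability for the coarse sigma-algebra says that [S_k] depends on orders up to [k] only; its
    independence of order [k+1] comes from this. *)
Lemma measurable_sojourn_time_cylinders k :
  (forall l i, (l <= k)%N -> K (l, i)) ->
  @measurable_fun _ _ T2 _ setT (sojourn_time U k).
Proof.
have mB l : (forall i, K (l, i)) -> @measurable_fun _ _ T2 _ setT (first_item U l).
  move=> Kl; rewrite /first_item unlock.
  elim: (index_enum _) => [|i s IHs]; first exact: measurable_cst.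
  exact: (measurable_minr (measurable_coordinate (X := X) (Kl i)) IHs).
have mM l : (forall i, K (l, i)) -> @measurable_fun _ _ T2 _ setT (last_item U l).
  move=> Kl; rewrite /last_item unlock.
  elim: (index_enum _) => [|i s IHs]; first exact: measurable_cst.
  exact: (measurable_maxr (measurable_coordinate (X := X) (Kl i)) IHs).
have mA l : (forall i, K (l, i)) -> @measurable_fun _ _ T2 _ setT (pick_time U l).
  by move=> Kl; exact: measurable_funB (mM l Kl) (mB l Kl).
elim: k => [|k IHk] Kk.
  have K0 i : K (0%N, i) by exact: Kk.
  exact: measurable_funD (mB 0 K0) (mA 0 K0).
have Kk1 i : K (k.+1, i) by exact: Kk.
apply: measurable_funD (mA k.+1 Kk1).
apply: measurable_maxr => //; apply: measurable_funB (mB k.+1 Kk1) (IHk _).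
by move=> l i lk; apply: Kk; exact: leqW.
Qed.

(** The position of item [i] enters only through the first component of the pair, so [K] may leave
    out the index [(k.+1, i)]. *)
Lemma measurable_last_is x k i :
  (forall l j, (l <= k)%N -> K (l, j)) ->
  (forall j, j != i -> K (k.+1, j)) ->
  measurable (last_is x k i : set (R * T2)).
Proof.
move=> Kk Ki.
have mS : measurable_fun setT (fun p : R * T2 => sojourn_time U k p.2).
  apply: (measurableT_comp (f := sojourn_time U k : T2 -> R)) => //.
  exact: measurable_sojourn_time_cylinders.
have mux : measurable_fun setT (fun p : R * T2 => p.1 - x).
  by apply: measurable_funB.
have mU j : j != i -> measurable_fun setT (fun p : R * T2 => U k.+1 j p.2).
  move=> ji; apply: (measurableT_comp (f := U k.+1 j : T2 -> R)) => //.
  exact: (measurable_coordinate (X := X) (Ki j ji)).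
rewrite [X in measurable X](_ : _ =
  (\bigcap_(j in [set j | j != i])
     ([set p : R * T2 | 0 <= U k.+1 j p.2] `&`
      [set p | p.1 - x <= U k.+1 j p.2] `&`
      [set p | U k.+1 j p.2 <= p.1] `&`
      (if (j < i)%N then [set p | U k.+1 j p.2 < p.1] else setT))) `&`
  [set p | p.1 - x <= sojourn_time U k p.2]); last first.
  rewrite predeqE => p; split => [[win pS]|[win pS]]; split => //.
    move=> j /= ji; have /windowP[? ? ? lt] := win j ji.
    by split => //; case: ifPn => // ?; exact: lt.
  move=> j ji; have := win j ji => -[[[? ?] ?]] lt; apply/windowP; split => //.
  by move=> h; move: lt; rewrite h.
apply: measurableI; last exact: measurable_ler_set.
apply: fin_bigcap_measurable => [|j ji]; first exact: finite_finset.
apply: measurableI; [apply: measurableI; [apply: measurableI|]|].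
- by apply: measurable_ler_set => //; exact: mU.
- by apply: measurable_ler_set => //; exact: mU.
- by apply: measurable_ler_set => //; exact: mU.
- by case: ifPn => // _; apply: measurable_ltr_set => //; exact: mU.
Qed.

End sigma.

(** The window lies in [0, 1] and its length is u - max(0, u - x) = min(u, x), whether or not the
    right endpoint belongs to it. *)
Lemma uniform_prob_window x i j u : 0 <= x -> 0 <= u <= 1 ->
  uniform_prob (@ltr01 R) (window x i j u) = (minr u x)%:E.
Proof.
move=> x0 /andP[u0 u1].
rewrite /uniform_prob integral_uniform_pdf setIidl; last first.
  by move=> v /windowP[v0 _ vu _]; rewrite /= in_itv /= v0 (le_trans vu).
rewrite (eq_integral (fun=> 1%:E)); last first.
  move=> v; rewrite inE => /windowP[v0 _ vu _].
  by rewrite /uniform_pdf v0 (le_trans vu) // subr0 invr1.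
rewrite integral_cst ?mul1e; last exact: measurable_itv.
rewrite /window /= lebesgue_measure_itv.
rewrite [X in (_ < X)%E](_ : _ = u%:E) /=; last by case: (j < i)%N.
(* The interval formula tests for positive length. When the test fails, [u = 0] or [x = 0], and the
   minimum is 0 as well. *)
rewrite lte_fin gt_max ltrBlDr ltrDl.
case: (lerP u x) => ux.
  rewrite max_l ?subr_le0 // oppr0 adde0.
  case: ifPn => //; rewrite negb_and -!leNgt => /orP[u0'|x0'].
    by suff -> : u = 0 by []; apply/le_anti; rewrite u0 u0'.
  by suff -> : u = 0 by []; apply/le_anti; rewrite u0 (le_trans ux).
rewrite (le_lt_trans x0 ux) /= max_r ?subr_ge0 ?(ltW ux) //.
case: ifPn => [_|]; first by rewrite opprB -EFinD addrC subrK.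
by rewrite -leNgt => x0'; suff -> : x = 0 by []; apply/le_anti; rewrite x0 x0'.
Qed.

Hypothesis indU : mutually_independent X.
Hypothesis uniU : forall k i, uniform01 (U k i).

Definition order_items k (i : 'I_n) : {fset nat * 'I_n} :=
  [fset (k, j) | j in [pred j | j != i]]%fset.

(** With [u] frozen, the [n - 1] windows form a cylinder over order [k+1], independent of [S_k], and
    each of them has probability [minr u x]. *)
Lemma last_is_section x k i u : 0 <= x -> 0 <= u <= 1 ->
  P [set w | last_is x k i (u, w)] =
  ((minr u x ^+ n.-1)%:E * P [set w | u - x <= sojourn_time U k w]%R)%E.
Proof.
move=> x0 u01.
pose E := fun q : nat * 'I_n => window x i q.2 u.
have mE q : measurable (E q) by exact: measurable_itv.
have -> : [set w | last_is x k i (u, w)] =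
    cylinder X (order_items k.+1 i) E `&` [set w | u - x <= sojourn_time U k w].
  rewrite predeqE => w; split => -[win uS]; split => //.
    by move=> [l j] /= /imfsetP[j' /= ji [-> ->]]; exact: win.
  by move=> j ji; apply: (win (k.+1, j)); apply/imfsetP; exists j.
rewrite (@cylinder_sigma_indep _ _ _ _ _ _ _ [set q | (q.1 <= k)%N]) //.
- congr (_ * _)%E; rewrite /cylinder (indU _ mE).
  rewrite (eq_big_seq (fun=> (minr u x)%:E)); last first.
    move=> [l j] /imfsetP[j' /= ji [-> ->]].
    by transitivity (uniform_prob (@ltr01 R) (window x i j' u));
      [exact: uniU | exact: uniform_prob_window].
  rewrite prodEFin big_imfset /=; last by move=> j1 j2 _ _ [].
  rewrite (perm_big (enum (predC1 i))) /=; last first.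
    apply: uniq_perm; rewrite ?enum_uniq ?enum_finmem_uniq //.
  by rewrite big_enum prodr_const cardC1 card_ord.
- by move=> [l j] /imfsetP[j' /= ji [-> _]] /=; rewrite ltnn.
- apply: (measurable_ler_set (T := g_sigma_algebraType _)) => //.
  by apply: measurable_sojourn_time_cylinders.
Qed.

(** A uniform law bounds the positions only almost surely; this provides the event of full
    probability on which the pointwise description holds. *)
Lemma order_in01 k :
  P (\bigcap_(i in [set: 'I_n]) (U k i @^-1` `[0, 1])) = 1%E.
Proof.
pose J := [fset (k, i) | i in 'I_n]%fset.
have -> : \bigcap_(i in [set: 'I_n]) (U k i @^-1` `[0, 1]) =
    cylinder X J (fun=> `[0, 1]%classic).
  rewrite predeqE => w; split=> h.
    by move=> [l j] /= /imfsetP[j' _ [-> ->]]; exact: h.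
  by move=> j _; apply: (h (k, j)); apply/imfsetP; exists j.
rewrite /cylinder indU // big1_seq // => -[l j] /andP[_ _].
transitivity (uniform_prob (@ltr01 R) `[0, 1]%classic); first exact: uniU.
by rewrite /uniform_prob integral_uniform_pdf1.
Qed.

Lemma prob_sojourn_timeS_le k x : 0 <= x ->
  P [set w | sojourn_time U k.+1 w <= x] =
  (n%:R%:E * \int[lebesgue_measure]_(u in `[0%R, 1%R])
    ((minr u x ^+ n.-1)%:E * P [set w | u - x <= sojourn_time U k w]%R))%E.
Proof.
move=> x0.
pose D i := [set w | last_is x k i (U k.+1 i w, w)].
(* Only the position that is conditioned on is removed: the other items of order [k+1] and all
   earlier orders stay in [K i]. *)
pose K i := [set q : nat * 'I_n | q != (k.+1, i)].
have mL i : measurable (last_is x k i :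
    set (R * g_sigma_algebraType (cylinders X (K i)))).
  apply: measurable_last_is => [l j lk|j ji]; rewrite /K /=.
    by apply/eqP => -[lk1 _]; rewrite lk1 ltnn in lk.
  by apply: contra_neq ji => -[].
have mD i : measurable (D i).
  rewrite -[D i]setTI; apply: (measurable_fun_pair (f := U k.+1 i)
    (g := id : T -> g_sigma_algebraType (cylinders X (K i)))) => //.
  exact: measurable_id_cylinders.
have PD i : P (D i) = (\int[lebesgue_measure]_(u in `[0%R, 1%R])
    ((minr u x ^+ n.-1)%:E * P [set w | u - x <= sojourn_time U k w]%R))%E.
  have mUi : measurable_fun setT (U k.+1 i : T -> measurableTypeR R).
    exact: (measurable_funPT (U k.+1 i)).
  rewrite /D (@indep_integral_section _ _ _ P _ X (k.+1, i) (K i) (last_is x k i)) //.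
  - pose V : {mfun T >-> measurableTypeR R} := HB.pack
      (U k.+1 i : T -> measurableTypeR R)
      (isMeasurableFun.Build _ _ T (measurableTypeR R) _ mUi).
    rewrite -(@ge0_integral_distribution _ _ _ _ _ P V
      (fun u => P [set w | last_is x k i (u, w)])) //; last first.
      exact: measurable_prob_section.
    rewrite (eq_measure_integral (uniform_prob (@ltr01 R))); last first.
      by move=> A mA _; exact: uniU.
    rewrite integral_uniform //; last exact: measurable_prob_section.
    rewrite subr0 invr1 mul1e; apply: eq_integral => u.
    by rewrite inE /= in_itv /= => u01; exact: last_is_section.
  - by rewrite /K /= eqxx.
set Om := \bigcap_(i in [set: 'I_n]) (U k.+1 i @^-1` `[0, 1]).
have mOm : measurable Om.
  apply: fin_bigcap_measurable => [|j _]; first exact: finite_finset.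
  exact: measurable_funPTI.
have POmC : P (~` Om) = 0%E by rewrite probability_setC // order_in01 subee.
have POm A : measurable A -> P A = P (A `&` Om).
  move=> mA; rewrite [LHS](measureDI P mA mOm).
  rewrite [X in (X + _)%E](_ : _ = 0%E) ?add0e //.
  apply/eqP; rewrite eq_le measure_ge0 andbT -[leRHS]POmC.
  by apply: le_measure => [| |w []//]; rewrite inE;
    [exact: measurableD | exact: measurableC].
(* Pass to [Om], where the event is the union of the [D i], then drop [Om] again. The union is
   disjoint by the tie-breaking. *)
rewrite POm; last exact: measurable_ler_set.
rewrite [X in P X](_ : _ = (\bigcup_(i in [set: 'I_n]) D i) `&` Om); last first.
  rewrite predeqE => w; split => [[Sx Omw]|[[i _ Di] Omw]]; split => //.
    have /(sojourn_timeS_leE x0 ) [] : forall i, 0 <= U k.+1 i w <= 1.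
      by move=> i; have := Omw i Logic.I.
    by move=> /(_ Sx)[i Di] _; exists i.
  by apply/(sojourn_timeS_leE x0) => [i0|]; [exact: Omw | exists i].
rewrite -POm; last first.
  by apply: fin_bigcup_measurable => // i; exact: finite_finset.
rewrite measure_fin_bigcup //=; last first.
  move=> i i' _ _ [w [Di Di']]; exact: last_is_inj Di Di'.
rewrite (fsbigE (enum 'I_n)) ?enum_uniq //=; last first.
  by move=> i _; rewrite mem_enum.
rewrite (eq_bigl predT) => [|i]; last by rewrite in_setT.
(* The integral in [PD] does not depend on [i], so the [n] summands are equal. *)
rewrite (eq_bigr (fun=> P (D (Ordinal n_gt0)))) => [|i _]; last by rewrite !PD.
by rewrite big_enum /= PD sumr_const card_ord mule_natl.
Qed.

End sojourn.

(** * Passage to the limit *)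

(** Near [z], the distribution function is its value at [z - 1] plus the integral of the density
    from [z - 1], which is continuous in its upper bound. *)
Lemma continuous_cdf_density d (T : measurableType d) (R : realType)
    (P : probability T R) (S : {RV P >-> R}) :
  has_density S -> continuous (fun z => fine (cdf S z)).
Proof.
move=> [f [mf f0 fE]] z.
pose mu := @lebesgue_measure R.
have intf : mu.-integrable setT (EFin \o f).
  apply/integrableP; split; first exact/measurable_EFinP.
  under eq_integral do rewrite gee0_abs ?lee_fin //.
  by rewrite -fE // probability_setT ltry.
have ab : z - 1 < z + 1 by lra.
have zab : z \in `]z - 1, z + 1[ by rewrite in_itv /=; lra.
have intfS A : measurable A -> mu.-integrable A (EFin \o f).
  by move=> mA; apply: integrableS intf.
have := parameterized_integral_continuous (ltW ab) (intfS _ (measurable_itv _)).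
move=> /(continuous_within_itvP _ ab)[/(_ z zab) cz _ _].
have FE y : z - 1 <= y -> fine (cdf S y) = fine (cdf S (z - 1)) +
    parameterized_integral lebesgue_measure (z - 1) y f.
  move=> zy; rewrite /cdf (itv_bndbnd_setU (x := BRight (z - 1))) //=.
  rewrite measureU //=; last first.
    by apply/seteqP; split => // w /= []; rewrite !in_itv /=; lra.
  rewrite fineD ?fin_num_measure //; congr (_ + _).
  rewrite [distribution P S _](fE _ (measurable_itv _)).
  rewrite integral_itv_obnd_cbnd //.
  by apply/measurable_EFinP; exact: measurable_funTS.
have : {for z, continuous (fun y => fine (cdf S (z - 1)) +
    parameterized_integral lebesgue_measure (z - 1) y f)}.
  by apply: cvgD cz; exact: cvg_cst.
have Fz := FE z.
rewrite /prop_for /continuous_at -Fz; last by rewrite gerBl ler01.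
apply: cvg_trans; apply: near_eq_cvg; near=> y; rewrite (FE y) //.
by apply: ltW; near: y; apply: lt_nbhsr; rewrite gtrBl ltr01.
Unshelve. all: end_near. Qed.

Section limit.
Context d d' (T : measurableType d) (T' : measurableType d') (R : realType).
Context (P : probability T R) (P' : probability T' R).
Context (Y : nat -> {RV P >-> R}) (S : {RV P' >-> R}).
Hypothesis YS : cvg_in_distribution Y S.
Hypothesis cS : continuous (fun z => fine (cdf S z)).

Lemma cvg_cdf z : cdf (Y k) z @[k --> \oo] --> cdf S z.
Proof.
apply: YS; rewrite /continuous_at.
have cdfz : cdf S z = (fine (cdf S z))%:E by rewrite fineK // fin_num_measure.
rewrite /prop_for cdfz; apply: cvg_EFin; [|exact: cS].
by apply: nearW => y; rewrite fin_num_measure.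
Qed.

(** [Y k] may have an atom at [t], so P(t <= Y_k) is squeezed between 1 - F_k(t) and 1 - F_k(s) for
    [s < t]; continuity of the limit at [t] closes the gap. *)
Lemma cvg_prob_ge t :
  P [set w | t <= Y k w] @[k --> \oo] --> (1 - cdf S t)%E.
Proof.
have fc z : fine (cdf (Y k) z) @[k --> \oo] --> fine (cdf S z).
  apply: fine_cvg; rewrite fineK ?fin_num_measure //; exact: cvg_cdf.
have mge s k : measurable [set w | s <= Y k w].
  by apply: measurable_ler_set => //; exact: measurable_funPT.
rewrite -[cdf S t]fineK ?fin_num_measure // -EFinB; apply: cvg_EFin.
  by apply: nearW => k; rewrite fin_num_measure.
have mle s k : measurable [set w | Y k w <= s].
  by apply: measurable_ler_set => //; exact: measurable_funPT.
have lower k : 1 - fine (cdf (Y k) t) <= fine (P [set w | t <= Y k w]).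
  rewrite -lee_fin EFinB !fineK ?fin_num_measure //.
  rewrite -[leLHS](_ : P (~` [set w | Y k w <= t]) = _).
    apply: le_measure; rewrite ?inE //; first exact: measurableC.
    by move=> w /= /negP; rewrite -ltNge => /ltW.
  by rewrite probability_setC.
have upper s k : s < t -> fine (P [set w | t <= Y k w]) <= 1 - fine (cdf (Y k) s).
  move=> st; rewrite -lee_fin EFinB !fineK ?fin_num_measure //.
  rewrite -[leRHS](_ : P (~` [set w | Y k w <= s]) = _).
    apply: le_measure; rewrite ?inE //; first exact: measurableC.
    by move=> w /= tY; apply/negP; rewrite -ltNge; exact: lt_le_trans tY.
  by rewrite probability_setC.
apply/cvgrPdist_le => /= e e0.
have [s st Fs] : exists2 s, s < t & fine (cdf S t) - fine (cdf S s) <= e / 2.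
  have /cvgrPdist_le/(_ (e / 2)) := @cS t.
  rewrite divr_gt0 // => /(_ isT) /nbhs_ballP[r /= r0 ballF].
  exists (t - r / 2); first by lra.
  apply: le_trans (ler_norm _) (ballF _ _).
  by rewrite /ball /= opprB addrC subrK gtr0_norm; lra.
have e2 : 0 < e / 2 by lra.
near=> k.
have : `|fine (cdf S t) - fine (cdf (Y k) t)| <= e / 2.
  by near: k; exact: (cvgrPdist_le _ _).1 (fc t) _ e2.
have : `|fine (cdf S s) - fine (cdf (Y k) s)| <= e / 2.
  by near: k; exact: (cvgrPdist_le _ _).1 (fc s) _ e2.
have := lower k; have := upper s k st.
rewrite !ler_norml; lra.
Unshelve. all: end_near. Qed.

End limit.

(** * Evaluation of the integral *)

Lemma continuous_integrable_itv (R : realType) (f : R -> R) (a b : R) :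
  continuous f -> (@lebesgue_measure R).-integrable `[a, b] (EFin \o f).
Proof.
move=> cf; apply: continuous_compact_integrable; first exact: segment_compact.
exact: continuous_subspaceT.
Qed.

Lemma Rintegral_exprn (R : realType) (n : nat) (x : R) : 0 <= x ->
  \int[lebesgue_measure]_(u in `[0, x]) u ^+ n = n.+1%:R^-1 * x ^+ n.+1.
Proof.
(* The fundamental theorem of calculus is applied on a nondegenerate interval, so [x = 0] is treated
   apart. *)
rewrite le_eqVlt => /predU1P[<-|x0].
  by rewrite set_itv1 /Rintegral integral_set1 expr0n mulr0.
pose G : R -> R := n.+1%:R^-1 \*: ((@id R) ^+ n.+1).
have GE u : G u = n.+1%:R^-1 * u ^+ n.+1 by rewrite /G /= fctE.
have dG (u : R) : is_derive u (1 : R) G (u ^+ n).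
  apply: (is_derive_eq (is_deriveZ _ (is_deriveX n.+1 (is_derive_id u 1)))).
  by rewrite /= /GRing.scale /= mulr1 mulrA mulVf ?mul1r ?pnatr_eq0.
have cG : continuous G.
  move=> u; apply: differentiable_continuous; apply/derivable1_diffP.
  by case: (dG u).
rewrite /Rintegral (@continuous_FTC2 _ _ G) //.
- by rewrite !GE expr0n mulr0 sube0.
- apply: continuous_subspaceT => u; exact: exprn_continuous.
- split => [u _||]; first by case: (dG u).
  + exact: (cvg_at_right_filter (cG 0)).
  + exact: (cvg_at_left_filter (cG x)).
- by move=> u _; rewrite derive1E; case: (dG u).
Qed.

Lemma Rintegral_shift (R : realType) (F : R -> R) (x a b : R) : a <= b ->
  continuous F ->
  \int[lebesgue_measure]_(u in `[a, b]) F (u - x) =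
  \int[lebesgue_measure]_(z in `[a - x, b - x]) F z.
Proof.
move=> ab cF; rewrite /Rintegral.
pose G u : R := u - x.
have dG (u : R) : is_derive u (1 : R) G 1 by exact: is_derive_shift.
have dG1 : G^`()%classic = cst 1.
  by apply/funext => u; rewrite derive1E; case: (dG u).
have cG : continuous G.
  move=> u; apply: differentiable_continuous; apply/derivable1_diffP.
  by case: (dG u).
rewrite (@integration_by_substitution_increasing _ G F a b) //.
- by congr fine; apply: eq_integral => u _ /=; rewrite dG1 /G /= !fctE mulr1.
- by move=> u v _ _; rewrite /G ltrD2r.
- by rewrite dG1 => u _; exact: cvg_cst.
- by rewrite dG1; exact: is_cvg_cst.
- by rewrite dG1; exact: is_cvg_cst.
- split => [u _||]; first by case: (dG u).
  + exact: (cvg_at_right_filter (cG a)).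
  + exact: (cvg_at_left_filter (cG b)).
- exact: continuous_subspaceT.
Qed.

Lemma Rintegral_min_exprn (R : realType) (F : R -> R) (n : nat) (x : R) :
  (0 < n)%N -> 0 <= x <= 1 -> continuous F -> (forall t, t <= 0 -> F t = 0) ->
  n%:R * \int[lebesgue_measure]_(u in `[0, 1])
           (minr u x ^+ n.-1 * (1 - F (u - x))) =
  n%:R * x ^+ n.-1 - n.-1%:R * x ^+ n
  - n%:R * x ^+ n.-1 * \int[lebesgue_measure]_(z in `[0, 1 - x]) F z.
Proof.
(* From here on [n] denotes the predecessor of the original [n]. *)
move=> n0 /andP[x0 x1] cF F0; case: n n0 => // n _ /=.
have cFx : continuous (fun u : R => F (u - x)).
  move=> u; apply: (@continuous_comp _ _ _ (fun u : R => u - x) F); last exact: cF.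
  by apply: cvgB; [exact: cvg_id | exact: cvg_cst].
have cG : continuous (fun u : R => 1 - F (u - x)).
  by move=> u; apply: cvgB; [exact: cvg_cst | exact: cFx].
have cH : continuous (fun u : R => minr u x ^+ n * (1 - F (u - x))).
  move=> u; apply: cvgM; last exact: cG.
  apply: (@continuous_comp _ _ _ (fun u : R => minr u x) (fun u => u ^+ n)).
    by apply: continuous_min; [exact: cvg_id | exact: cvg_cst].
  exact: exprn_continuous.
have /eqP := @Rintegral_itvB R (fun u => minr u x ^+ n * (1 - F (u - x)))
  (BLeft 0) (BRight 1) x (continuous_integrable_itv _ _ cH) x0 x1.
rewrite subr_eq => /eqP ->.
(* Left of [x] the argument [t - x] is nonpositive, so [F] vanishes and a pure power remains. *)
have -> : \int[lebesgue_measure]_(t in `[0, x]) (minr t x ^+ n * (1 - F (t - x))) =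
    n.+1%:R^-1 * x ^+ n.+1.
  rewrite -Rintegral_exprn //; apply: eq_Rintegral => u.
  rewrite inE /= in_itv /= => /andP[u0 ux].
  by rewrite min_l // F0 ?subr_le0 // subr0 mulr1.
(* Right of [x] the minimum is the constant [x], and the shift [z = t - x] brings the integral of
   [F] to [0, 1 - x]. *)
have -> : \int[lebesgue_measure]_(t in `]x, 1]) (minr t x ^+ n * (1 - F (t - x))) =
    x ^+ n * (1 - x - \int[lebesgue_measure]_(z in `[0, 1 - x]) F z).
  rewrite Rintegral_itv_obnd_cbnd; last first.
    apply: integrableS (continuous_integrable_itv x 1 cH) => //.
    exact: subset_itv_oc_cc.
  transitivity (\int[lebesgue_measure]_(u in `[x, 1]) (x ^+ n * (1 - F (u - x)))).
    apply: eq_Rintegral => u; rewrite inE /= in_itv /= => /andP[xu _].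
    by rewrite min_r.
  rewrite RintegralZl //; last exact: continuous_integrable_itv cG.
  rewrite RintegralB //; last 2 first.
  - by apply: continuous_integrable_itv => u; exact: cvg_cst.
  - exact: continuous_integrable_itv.
  rewrite Rintegral_cst // Rintegral_shift // subrr mul1r.
  rewrite /= lebesgue_measure_itv /= lte_fin.
  case: ltP => x1' //; have -> : x = 1 by apply/le_anti; rewrite x1 x1'.
  by rewrite subrr.
rewrite mulrDr mulVKf ?pnatr_eq0 // exprS -natr1.
ring.
Qed.

(** * The integral equation for the limiting distribution function, and the closed formula *)

Lemma cdf_limit_integral (R : realType) (n : nat) (n_gt0 : (0 < n)%N)
    (d : measure_display) (T : measurableType d) (P : probability T R)
    (U : nat -> 'I_n -> {RV P >-> R})
    (indU : mutually_independent (fun ki : nat * 'I_n => U ki.1 ki.2))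
    (uniU : forall k i, uniform01 (U k i))
    (d' : measure_display) (T' : measurableType d') (P' : probability T' R)
    (S : {RV P' >-> R}) (US : cvg_in_distribution (sojourn_RV U) S)
    (cS : continuous (fun z => fine (cdf S z))) (x : R) : 0 <= x ->
  fine (cdf S x) = n%:R * \int[lebesgue_measure]_(u in `[0, 1])
    (minr u x ^+ n.-1 * (1 - fine (cdf S (u - x)))).
Proof.
move=> x0; pose mu := @lebesgue_measure R.
pose g k u := ((minr u x ^+ n.-1)%:E *
  P [set w | u - x <= sojourn_time U k w]%R)%E.
pose h u := (minr u x ^+ n.-1 * (1 - fine (cdf S (u - x))))%:E.
have gh u : g k u @[k --> \oo] --> h u.
  rewrite /h EFinM EFinB fineK ?fin_num_measure //.
  by apply: cvgeZl => //; exact: (cvg_prob_ge US cS).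
have mmin : measurable_fun setT (fun u : R => minr u x ^+ n.-1).
  by apply: measurable_funX; exact: measurable_minr.
have mS k t : measurable [set w | t <= sojourn_time U k w].
  by apply: measurable_ler_set => //; exact: measurable_sojourn_time.
have minr01 u : u \in `[0, 1]%R -> 0 <= minr u x ^+ n.-1 <= 1.
  rewrite in_itv /= => /andP[u0 u1].
  have m0 : 0 <= minr u x by rewrite le_min u0 x0.
  by rewrite exprn_ge0 // exprn_ile1 // ge_min u1.
(* Dominated convergence on [0, 1] with bound 1: each integrand is a power of a number in [0, 1]
   times a probability. *)
have [inth _ gh1] : [/\ mu.-integrable `[0, 1] h,
    [sequence (\int[mu]_(u in `[0%R, 1%R]) `|g k u - h u|)%E]_k @ \oo --> 0%E &
    [sequence (\int[mu]_(u in `[0%R, 1%R]) g k u)%E]_k @ \oo -->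
      (\int[mu]_(u in `[0%R, 1%R]) h u)%E].
  apply: (@dominated_convergence _ _ _ mu `[0, 1]%classic _ g h (cst 1%E)) => //.
  - move=> k; apply: measurable_funTS; apply: emeasurable_funM.
      exact/measurable_EFinP.
    rewrite [X in measurable_fun _ X](_ : _ =
      EFin \o (fun u => fine (P [set w | u - x <= sojourn_time U k w]))); last first.
      by apply/funext => u /=; rewrite fineK // fin_num_measure.
    (* P(S_k >= u - x) is nonincreasing in [u], hence measurable, with no continuity of the law of
       [S_k]. *)
    apply/measurable_EFinP; apply: nonincreasing_measurable => // u v uv.
    apply: fine_le; rewrite ?fin_num_measure //.
    apply: le_measure; rewrite ?inE // => w /=; apply: le_trans.
    by rewrite lerD2r.
  - apply: measurable_funTS; apply/measurable_EFinP; apply: measurable_funM => //.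
    apply: measurable_funB => //.
    apply: (measurableT_comp (continuous_measurable_fun cS)).
    exact: measurable_funB.
  - by apply: aeW => u _; exact: gh.
  - by apply: (continuous_integrable_itv 0 1) => u; exact: cvg_cst.
  - apply: aeW => u k u01; have /andP[m0 m1] := minr01 u u01.
    rewrite gee0_abs ?mule_ge0 ?lee_fin //.
    rewrite -[leRHS]mule1; apply: lee_pmul; rewrite ?lee_fin //.
    exact: probability_le1.
have cdfE k : cdf (sojourn_RV U k.+1) x =
    (n%:R%:E * \int[mu]_(u in `[0%R, 1%R]) g k u)%E.
  by rewrite -prob_sojourn_timeS_le // /cdf set_itvNyc.
(* The recurrence expresses the law of index [k+1], so the limit is taken along the shifted
   sequence; uniqueness of limits then gives the equation. *)
have := @cvg_cdf _ _ _ _ _ _ _ _ _ US cS x; rewrite -cvg_shiftS.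
rewrite (_ : [sequence _]_k =
  (fun k => (n%:R%:E * \int[mu]_(u in `[0%R, 1%R]) g k u)%E)); last first.
  by apply/funext => k; exact: cdfE.
move=> Fx; have -> : cdf S x = (n%:R%:E * \int[mu]_(u in `[0%R, 1%R]) h u)%E.
  by apply: (cvg_unique (@ereal_hausdorff R) Fx); exact: cvgeZl gh1.
by rewrite fineM // integrable_fin_num.
Qed.

Theorem mainTheorem4 (R : realType) (n : nat) (n_ge2 : (2 <= n)%N)
    (d : measure_display) (T : measurableType d) (P : probability T R)
    (U : nat -> 'I_n -> {RV P >-> R})
    (U_indep : mutually_independent (fun ki : nat * 'I_n => U ki.1 ki.2))
    (U_unif : forall (k : nat) (i : 'I_n), uniform01 (U k i))
    (d' : measure_display) (T' : measurableType d') (P' : probability T' R)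
    (S : {RV P' >-> R})
    (S_limit : cvg_in_distribution (sojourn_RV U) S)
    (S_range : {ae P', forall w, 0 <= S w <= 1})
    (S_cdf0 : cdf S 0 = 0%E)
    (S_density : has_density S)
    (x : R) (x01 : 0 <= x <= 1) :
  fine (cdf S x) =
    n%:R * x ^+ n.-1 - n.-1%:R * x ^+ n
    - n%:R * x ^+ n.-1 *
      \int[lebesgue_measure]_(z in `[0, 1 - x]) fine (cdf S z).
Proof.
have n_gt0 : (0 < n)%N by exact: ltnW.
have cS := continuous_cdf_density S_density.
(* Vanishing at 0 extends to negative arguments by monotonicity; this covers the values [u - x] with
   [u <= x]. *)
have cdf0 t : t <= 0 -> fine (cdf S t) = 0.
  move=> t0; suff -> : cdf S t = 0%E by [].
  by apply/eqP; rewrite eq_le cdf_ge0 andbT -[leRHS]S_cdf0; exact: cdf_nondecreasing.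
rewrite -(Rintegral_min_exprn n_gt0 x01 cS cdf0).
have /andP[x0 _] := x01.
by rewrite (cdf_limit_integral n_gt0 U_indep U_unif S_limit cS x0).
Qed.
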